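(* For every $\epsilon>0$ there exists a positive integer $T_\epsilon$, with $T_\epsilon=O(\mathrm{polylog}(1/\epsilon))$, such that for every real $n>0$, every integer $\ell$ and every integer $k\ge 0$, the restriction of $\exp(-nE(p\|q))$ to the block $B_{\ell,k}$ has an $O(\epsilon)$-accurate $T_\epsilon$-term separated approximation. That is, there exist real-valued functions $\alpha_i(p)$ and $\beta_i(q)$, $1\le i\le T_\epsilon$ (which may depend on $\epsilon,n,\ell,k$), such that for all $(p,q)\in B_{\ell,k}$ $$\exp(-nE(p\|q))=\sum_{i=1}^{T_\epsilon}\alpha_i(p)\beta_i(q)+O(\epsilon).$$
   Context: The divergence function is $E(p\|q)=p\ln(p/q)-(p-q)$ for $p,q\ge 0$, $(p,q)\neq(0,0)$, with the conventions $0\ln 0=0$ (so $E(0\|q)=q$ for $q>0$) and $E(p\|0)=+\infty$ for $p>0$ (so $\exp(-nE(p\|0))=0$). For each integer $\ell$ and each integer $k\ge 0$, the block $B_{\ell,k}\subset[0,\infty)^2$ (first coordinate $p$, second coordinate $q$) is $$B_{\ell,k}=\begin{cases}[k/2^\ell,(k+1)/2^\ell]\times[(k+1)/2^\ell,(k+2)/2^\ell], & k\text{ even},\\ [k/2^\ell,(k+1)/2^\ell]\times[(k-1)/2^\ell,k/2^\ell], & k\text{ odd}.\end{cases}$$ Asymptotic notation: $T_\epsilon=O(\mathrm{polylog}(1/\epsilon))$ means that there are absolute constants $A,m>0$ with $T_\epsilon\le A(\ln(1/\epsilon))^m$ for all $0<\epsilon\le 1/2$. The error term $O(\epsilon)$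 denotes a quantity of absolute value at most $C\epsilon$, with $C$ an absolute constant independent of $\epsilon,n,\ell,k,p,q$. *)

(* Defs.v *)
From HB Require Import structures.
From mathcomp Require Import all_boot all_order all_algebra.
From mathcomp Require Import all_classical all_reals all_analysis.
Set Implicit Arguments.
Unset Strict Implicit.
Unset Printing Implicit Defensive.
Import Order.TTheory GRing.Theory Num.Theory.
Import numFieldNormedType.Exports.
Local Open Scope classical_set_scope.
Local Open Scope ring_scope.

(* For p = 0 the summand p * ln (p / q) is 0, matching 0 ln 0 = 0, so
   divergence 0 q = q. The value at p = q = 0 is a dummy: no block contains
   the origin. *)
Definition divergence (R : realType) (p q : R) : \bar R :=
  if (0 < p) && (q == 0) then +oo%E else (p * ln (p / q) - (p - q))%:E.

(* expeR -oo = 0, so this is 0 when divergence p q = +oo and n > 0. *)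
Definition exp_divergence (R : realType) (n p q : R) : \bar R :=
  expeR (- (n%:E * divergence p q))%E.

(* l is a signed integer, so 2 ^ l is an integer power; the first coordinate is
   p, the second is q. *)
Definition block (R : realType) (l : int) (k : nat) : set (R * R) :=
  let x (j : nat) : R := j%:R / 2 ^ l in
  if odd k then `[x k, x k.+1] `*` `[x k.-1, x k]
  else `[x k, x k.+1] `*` `[x k.+1, x k.+2].

Definition polylog_bounded (R : realType) (T : R -> nat) : Prop :=
  exists A m : R, [/\ 0 < A, 0 < m &
    forall eps : R, 0 < eps <= 2^-1 -> (T eps)%:R <= A * ln (1 / eps) `^ m].

Definition separated_approx (R : realType) (D : set (R * R))
    (f : R -> R -> \bar R) (T : nat) (delta : R) : Prop :=
  exists alpha beta : 'I_T -> R -> R, forall p q : R, D (p, q) ->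
    (`|f p q - (\sum_(i < T) alpha i p * beta i q)%:E| <= delta%:E)%E.

(* Main.v *)
Require Import Defs.
From HB Require Import structures.
From mathcomp Require Import all_boot all_order all_algebra.
From mathcomp Require Import all_classical all_reals all_analysis.
From mathcomp Require Import ring lra.
Set Implicit Arguments.
Unset Strict Implicit.
Unset Printing Implicit Defensive.
Import Order.TTheory GRing.Theory Num.Theory.
Import numFieldNormedType.Exports.
Local Open Scope classical_set_scope.
Local Open Scope ring_scope.

(* Let c be the coordinate shared by the p-side and the q-side of the block, so
   that p and q lie on opposite sides of c. Then
     E(p||q) = E(p||c) + E(c||q) - (p - c) ln(q/c),   (p - c) ln(q/c) <= 0,
   hence exp(-n E(p||q)) is the product of a function of p, a function of q and
   exp(x), x = n (p - c) ln(q/c), with all three factors in [0, 1]. Where one of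
   the first two factors is at most eps, approximate by 0. Elsewhere
   n E(p||c) and n E(c||q) are at most ln(1/eps), which forces
   |x| <= 12 ln(1/eps), so the Taylor polynomial of exp of degree
   O(ln(1/eps)), whose monomials separate, is accurate to eps. *)

(** * Estimates for the exponential *)

(* Since j >= m in the tail, |x|^j <= a^-m (a|x|)^j with a = e. *)
Lemma expR_taylor_remainder (R : realType) (x : R) (m : nat) :
  `|expR x - \sum_(i < m) x ^+ i / i`!%:R| <= expR (expR 1 * `|x| - m%:R).
Proof.
set a : R := expR 1.
have a1 : 1 <= a by rewrite /a -expR0 ler_expR.
have a0 : 0 < a := lt_le_trans ltr01 a1.
set s := \sum_(i < m) _.
have cvx := @is_cvg_series_exp_coeff R x.
have -> : expR x - s = limn (fun k => series (exp_coeff x) k - s).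
  by apply/esym/cvg_lim => //; apply: cvgB; [exact: cvx|exact: cvg_cst].
have cvs : cvgn (fun k => series (exp_coeff x) k - s).
  by apply: is_cvgB; [exact: cvx|exact: is_cvg_cst].
rewrite -lim_norm//; apply: limr_le; first exact: is_cvg_norm.
near=> k.
have mk : (m <= k)%N by near: k; exists m.
have -> : series (exp_coeff x) k - s = \sum_(m <= i < k) x ^+ i / i`!%:R.
  rewrite /series /= (big_cat_nat (leq0n m) mk)/= /s big_mkord.
  by rewrite addrAC subrr add0r.
apply: (le_trans (ler_norm_sum _ _ _)).
have -> : expR (a * `|x| - m%:R) = a ^- m * expR (a * `|x|).
  by rewrite expRD mulrC expRN /a -expRM_natl mulr1.
apply: (@le_trans _ _ (a ^- m * \sum_(m <= i < k) (a * `|x|) ^+ i / i`!%:R)).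
  rewrite mulr_sumr; apply: ler_sum_nat => i /andP[mi _].
  rewrite normrM normrX (@ger0_norm _ i`!%:R^-1) ?invr_ge0// exprMn.
  have -> : a ^+ i = a ^+ m * a ^+ (i - m) by rewrite -exprD subnKC.
  rewrite !mulrA mulVf ?mul1r; last first.
    by rewrite expf_neq0// gt_eqF.
  by rewrite ler_pM2r ?invr_gt0 ?ltr0n ?fact_gt0// ler_peMl ?exprn_ge0// exprn_ege1.
rewrite ler_pM2l ?invr_gt0 ?exprn_gt0//.
have ax0 : 0 <= a * `|x| by rewrite mulr_ge0// ltW.
apply: (@le_trans _ _ (series (exp_coeff (a * `|x|)) k)); last first.
  apply: nondecreasing_cvgn_le; last exact: is_cvg_series_exp_coeff.
  by apply: nondecreasing_series => i _ _; exact: exp_coeff_ge0.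
rewrite /series /= [leRHS](big_cat_nat (leq0n m) mk)/= ler_wpDl// sumr_ge0// => i _.
exact: exp_coeff_ge0.
Unshelve. all: by end_near. Qed.

(** With v = 2 y and z = exp(y), the identity exp(v) - 1 - v = (z - 1)^2 + 2 (z - 1 - y) leaves at
    least (z - 1)^2, and |z - 1| >= |y| / 2. *)
Lemma sqr_le_expR_sub (R : realType) (v : R) :
  -2 <= v -> v ^+ 2 <= 16 * (expR v - 1 - v).
Proof.
move=> v2; have [y vy] : exists y, v = y + y by exists (v / 2); lra.
have h := expR_ge1Dx y; have h' := expR_ge1Dx (- y).
have E : expR y * expR (- y) = 1 by rewrite expRxMexpNx_1.
have g := expR_gt0 y; have g' := expR_gt0 (- y).
rewrite vy expRD; move: (expR y) h E g => z h E g.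
suff : (y / 2) ^+ 2 <= (z - 1) ^+ 2 by move=> ?; lra.
have [y0|y0] := leP 0 y.
  by rewrite ler_sqr ?nnegrE; lra.
have zy : z * (1 - y) <= 1 by rewrite -[leRHS]E ler_pM2l.
have y1 : -1 <= y by lra.
(* Here v >= -2 enters: 1 / (1 - y) <= 1 + y / 2 for -1 <= y <= 0. *)
have zz : z <= 1 + y / 2 by nra.
by rewrite -sqrrN -[leRHS]sqrrN ler_sqr ?nnegrE; lra.
Qed.

(** * Lower bounds on the divergence, and the cross term *)

(** The finite branch of [divergence], kept in R for the estimates; the two agree for q > 0. *)
Definition divergenceR (R : realType) (p q : R) : R := p * ln (p / q) - (p - q).

(** With s = sqrt p > 0 and r = sqrt q, ln(r/s) <= r/s - 1 gives p ln(p/q) = -2 s^2 ln(r/s) >= 2 s^2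
    - 2 s r. *)
Lemma divergenceR_ge_hellinger (R : realType) (p q : R) : 0 <= p -> 0 < q ->
  (Num.sqrt p - Num.sqrt q) ^+ 2 <= divergenceR p q.
Proof.
move=> p0 q0; rewrite /divergenceR.
have r0 : 0 < Num.sqrt q by rewrite sqrtr_gt0.
have qE : q = Num.sqrt q ^+ 2 by rewrite sqr_sqrtr// ltW.
have [p00|pn0] := eqVneq p 0.
  by rewrite p00 mul0r sqrtr0 !sub0r opprK sqrrN sqr_sqrtr// ltW.
have s0 : 0 < Num.sqrt p by rewrite sqrtr_gt0 lt_neqAle eq_sym pn0.
have pE : p = Num.sqrt p ^+ 2 by rewrite sqr_sqrtr.
rewrite [in leRHS]pE [in leRHS]qE.
move: (Num.sqrt p) (Num.sqrt q) s0 r0 => s r s0 r0 {pE qE}.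
have h : ln (r / s) <= r / s - 1.
  have {1}-> : r / s = 1 + (r / s - 1) by lra.
  by apply: le_ln1Dx; have := divr_gt0 r0 s0; lra.
have -> : ln (s ^+ 2 / r ^+ 2) = - 2 * ln (r / s).
  have rs : s ^+ 2 / r ^+ 2 = ((r / s) ^+ 2)^-1 by field; rewrite !gt_eqF.
  by rewrite rs lnV ?posrE ?exprn_gt0 ?divr_gt0// lnXn ?divr_gt0//; lra.
have {}h : s ^+ 2 * ln (r / s) <= s * r - s ^+ 2.
  have -> : s * r - s ^+ 2 = s ^+ 2 * (r / s - 1) by field; rewrite gt_eqF.
  by rewrite ler_pM2l// exprn_gt0.
nra.
Qed.

Lemma divergenceR_ge0 (R : realType) (p q : R) : 0 <= p -> 0 < q ->
  0 <= divergenceR p q.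
Proof.
by move=> p0 q0; exact: le_trans (sqr_ge0 _) (divergenceR_ge_hellinger p0 q0).
Qed.

(** Factor (p - c)^2 = (s + r)^2 (s - r)^2 with s = sqrt p, r = sqrt c. The Hellinger bound controls
    the second factor; s <= 2 r bounds the first by 9 c. *)
Lemma divergenceR_ge_sqr (R : realType) (p c : R) : 0 < c -> 0 <= p <= 2 * c ->
  (p - c) ^+ 2 <= 9 * c * divergenceR p c.
Proof.
move=> c0 /andP[p0 pc]; have := divergenceR_ge_hellinger p0 c0.
have r0 := sqrtr_ge0 c; have s0 := sqrtr_ge0 p.
have := sqr_sqrtr p0; have := sqr_sqrtr (ltW c0).
move: (Num.sqrt p) (Num.sqrt c) r0 s0 => s r r0 s0 rE sE h.
apply: (@le_trans _ _ (9 * c * (s - r) ^+ 2)); last first.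
  by rewrite ler_pM2l// mulr_gt0.
have sr : s <= 2 * r by rewrite -ler_sqr ?nnegrE; nra.
have -> : (p - c) ^+ 2 = (s + r) ^+ 2 * (s - r) ^+ 2.
  by rewrite -sE -rE; ring.
apply: ler_wpM2r; first exact: sqr_ge0.
by rewrite -rE; nra.
Qed.

(** Brings E(c||q) to the form of [sqr_le_expR_sub], with v = ln(q/c). *)
Lemma divergenceR_expR (R : realType) (c q : R) : 0 < c -> 0 < q ->
  divergenceR c q = c * (expR (ln (q / c)) - 1 - ln (q / c)).
Proof.
move=> c0 q0; rewrite lnK ?posrE ?divr_gt0// /divergenceR.
have -> : c / q = (q / c)^-1 by rewrite invf_div.
by rewrite lnV ?posrE ?divr_gt0//; field; rewrite gt_eqF.
Qed.

(** Three-point identity of the Bregman divergence generated by t ln t - t. *)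
Lemma divergenceR_split (R : realType) (c p q : R) :
  0 < c -> 0 <= p -> 0 < q ->
  divergenceR p q =
  divergenceR p c + divergenceR c q - (p - c) * ln (q / c).
Proof.
move=> c0 p0 q0; rewrite /divergenceR.
have [->|pn0] := eqVneq p 0.
  by rewrite !mul0r !ln_div ?posrE//; lra.
have {}p0 : 0 < p by rewrite lt_neqAle eq_sym pn0.
by rewrite !ln_div ?posrE//; ring.
Qed.

(** For v = ln(q/c) >= -2, multiply n (p - c)^2 <= 9 c L by n c v^2 <= 16 L; then 12 = sqrt(9 *
    16). *)
Lemma cross_term_bound (R : realType) (n c p q L : R) : 0 < n -> 0 < c ->
  0 <= p <= 2 * c -> 0 < q ->
  n * divergenceR p c <= L -> n * divergenceR c q <= L ->
  `|n * (p - c) * ln (q / c)| <= 12 * L.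
Proof.
move=> n0 c0 pc q0 hp hq.
have p0 : 0 <= p by case/andP: pc.
have L0 : 0 <= L.
  by apply: le_trans hp; rewrite mulr_ge0 ?divergenceR_ge0// ltW.
have hp' := divergenceR_ge_sqr c0 pc.
have {}hq : n * c * (expR (ln (q / c)) - 1 - ln (q / c)) <= L.
  by rewrite -mulrA -divergenceR_expR.
move: (ln (q / c)) hq => v hq.
have nc0 : 0 < n * c by rewrite mulr_gt0.
have [v2|v2] := leP (-2) v.
  have {}hq : n * c * v ^+ 2 <= 16 * L.
    apply: (@le_trans _ _ (n * c * (16 * (expR v - 1 - v)))); last by lra.
    by rewrite ler_pM2l// sqr_le_expR_sub.
  have {}hp : n * (p - c) ^+ 2 <= 9 * c * L.
    apply: (@le_trans _ _ (n * (9 * c * divergenceR p c))).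
      by rewrite ler_pM2l.
    by rewrite mulrCA ler_pM2l// mulr_gt0.
  rewrite -ler_sqr ?nnegrE ?mulr_ge0// real_normK ?num_real//.
  apply: (@le_trans _ _ (9 * L * (n * c * v ^+ 2))); last first.
    have -> : (12 * L) ^+ 2 = 9 * L * (16 * L) by ring.
    by rewrite ler_wpM2l// mulr_ge0.
  have -> : (n * (p - c) * v) ^+ 2 = n * v ^+ 2 * (n * (p - c) ^+ 2) by ring.
  have -> : 9 * L * (n * c * v ^+ 2) = n * v ^+ 2 * (9 * c * L) by ring.
  by rewrite ler_wpM2l// mulr_ge0 ?sqr_ge0// ltW.
(* For v < -2 a linear bound suffices: exp(v) - 1 - v >= -v/2, which gives 2 L. *)
have pc' : `|p - c| <= c by rewrite ler_norml; lra.
have e0 := expR_gt0 v.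
have : n * c * (- v / 2) <= L.
  by apply: le_trans hq; rewrite ler_pM2l//; lra.
rewrite !normrM (gtr0_norm n0) (ltr0_norm (_ : v < 0)); last by lra.
have : n * `|p - c| * - v <= n * c * - v.
  by rewrite ler_pM2r ?ler_pM2l//; lra.
lra.
Qed.

(** * Separated approximation across a common coordinate *)

Lemma exp_divergence_pos (R : realType) (n p q : R) : 0 < q ->
  exp_divergence n p q = (expR (- (n * divergenceR p q)))%:E.
Proof. by move=> q0; rewrite /exp_divergence /divergence gt_eqF// andbF. Qed.

Lemma exp_divergence_q0 (R : realType) (n p : R) : 0 < n -> 0 < p ->
  exp_divergence n p 0 = 0%E.
Proof.
by move=> n0 p0; rewrite /exp_divergence /divergence p0 eqxx/= gt0_muley// lte_fin.
Qed.

Lemma separated_approx_opposite_sides (R : realType) (D : set (R * R))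
    (c n eps : R) (m : nat) :
  0 < c -> 0 < n -> 0 < eps ->
  (forall p q, D (p, q) ->
    [/\ 0 <= p <= 2 * c, 0 <= q & (p - c) * (q - c) <= 0]) ->
  (12 * expR 1 + 1) * ln (1 / eps) <= m%:R ->
  separated_approx D (exp_divergence n) m eps.
Proof.
move=> c0 n0 eps0 DS Lm; set L := ln (1 / eps) in Lm.
have epsE : expR (- L) = eps.
  by rewrite /L -lnV ?posrE ?divr_gt0// div1r invrK lnK.
exists (fun i p => if n * divergenceR p c <= L then
    expR (- (n * divergenceR p c)) * ((n * (p - c)) ^+ i / i`!%:R) else 0).
(* The test 0 < q is needed since [ln 0 = 0] makes [divergenceR c 0] equal to -c instead of
   infinity. *)
exists (fun i q => if (0 < q) && (n * divergenceR c q <= L) then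
    expR (- (n * divergenceR c q)) * ln (q / c) ^+ i else 0).
move=> p q /DS[/[dup] pc /andP[p0 _] q0 pq].
have [q00|qn0] := eqVneq q 0.
  (* At q = 0, lying on opposite sides of c forces p >= c > 0. *)
  rewrite q00 exp_divergence_q0//; last by rewrite q00 in pq; nra.
  rewrite big1 => [|i _]; last by rewrite ltxx /= mulr0.
  by rewrite sube0 abse0 lee_fin ltW.
have {qn0}q0 : 0 < q by rewrite lt_neqAle eq_sym qn0.
rewrite exp_divergence_pos// -EFinB abse_EFin lee_fin q0/=.
rewrite (divergenceR_split c0 p0 q0).
set a := divergenceR p c; set b := divergenceR c q.
have na0 : 0 <= n * a by rewrite mulr_ge0 ?divergenceR_ge0// ltW.
have nb0 : 0 <= n * b by rewrite mulr_ge0 ?divergenceR_ge0// ltW.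
set x := n * (p - c) * ln (q / c).
have x0 : x <= 0.
  rewrite /x -mulrA; apply: mulr_ge0_le0; first exact: ltW.
  have [qc|qc|->] := ltgtP q c; last by rewrite divff ?gt_eqF// ln1 mulr0.
  - apply: mulr_ge0_le0; first by nra.
    by rewrite ln_le0// ler_pdivrMr// mul1r ltW.
  - apply: mulr_le0_ge0; first by nra.
    by rewrite ln_ge0// ler_pdivlMr// mul1r ltW.
have fE : - (n * (a + b - (p - c) * ln (q / c))) = - (n * a) - n * b + x.
  by rewrite /x; ring.
rewrite fE.
(* If eps > 1, then L < 0 <= n a, so this cutoff covers that case too. *)
have [ha|ha] := leP (n * a) L; last first.
  rewrite big1 => [|i _]; last by rewrite mul0r.
  by rewrite subr0 ger0_norm ?expR_ge0// -epsE ler_expR; lra.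
have [hb|hb] := leP (n * b) L; last first.
  rewrite big1 => [|i _]; last by rewrite mulr0.
  by rewrite subr0 ger0_norm ?expR_ge0// -epsE ler_expR; lra.
have -> : \sum_(i < m) (expR (- (n * a)) * ((n * (p - c)) ^+ i / i`!%:R) *
    (expR (- (n * b)) * ln (q / c) ^+ i)) =
    expR (- (n * a) - n * b) * \sum_(i < m) x ^+ i / i`!%:R.
  rewrite mulr_sumr; apply: eq_bigr => i _.
  by rewrite expRD [x ^+ i]exprMn; ring.
rewrite expRD -mulrBr normrM (ger0_norm (expR_ge0 _)).
apply: (@le_trans _ _ `|expR x - \sum_(i < m) x ^+ i / i`!%:R|).
  by rewrite ler_piMl// -expR0 ler_expR; lra.
(* The choice of m gives e |x| - m <= 12 e L - (12 e + 1) L = -L. *)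
apply: (le_trans (expR_taylor_remainder _ _)); rewrite -epsE ler_expR.
have := cross_term_bound n0 c0 pc q0 ha hb; rewrite -/x => hx.
have : expR 1 * `|x| <= expR 1 * (12 * L) by rewrite ler_pM2l ?expR_gt0.
lra.
Qed.

(** * Geometry of the blocks and number of terms *)

(** The shared endpoint c is k/2^l for odd k and (k+1)/2^l for even k. It is at least the side
    length 2^-l, whence p <= 2 c. *)
Lemma block_opposite_sides (R : realType) (l : int) (k : nat) :
  exists2 c : R, 0 < c & forall p q, block l k (p, q) ->
    [/\ 0 <= p <= 2 * c, 0 <= q & (p - c) * (q - c) <= 0].
Proof.
have h0 : 0 < (2 ^ l : R)^-1 by rewrite invr_gt0 exprz_gt0.
rewrite /block; move: (2 ^ l : R)^-1 h0 => h h0.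
case: (boolP (odd k)) => ok.
  (* After the case split, [k.+1] is the original odd index. *)
  case: k ok => // k _; exists (k.+1%:R * h); first by rewrite mulr_gt0.
  move=> p q [] /=; rewrite !in_itv/= => /andP[p1 p2] /andP[q1 q2].
  have kh : 0 <= k%:R * h by rewrite mulr_ge0// ltW.
  rewrite -!natr1 in p1 p2 q1 q2 *; split; last by nra.
    by apply/andP; split; lra.
  by lra.
exists (k.+1%:R * h); first by rewrite mulr_gt0.
move=> p q [] /=; rewrite !in_itv/= => /andP[p1 p2] /andP[q1 q2].
have kh : 0 <= k%:R * h by rewrite mulr_ge0// ltW.
rewrite -!natr1 in p1 p2 q1 q2 *; split; last by nra.
  by apply/andP; split; lra.
by lra.
Qed.

(** The exponent is 1: for eps <= 1/2 the added 1 is at most ln(1/eps) / ln 2. *)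
Lemma polylog_bounded_truncn (R : realType) (M : R) : 0 <= M ->
  polylog_bounded (fun eps => (Num.truncn (M * ln (1 / eps))).+1).
Proof.
move=> M0; have ln2 : 0 < ln (2 : R) by rewrite ln_gt0// ltr1n.
exists (M + (ln 2)^-1), 1; split; [|exact: ltr01|].
  by rewrite ltr_wpDl// invr_gt0.
move=> eps /andP[eps0 eps2].
have hL : ln 2 <= ln (1 / eps).
  by rewrite ler_ln ?posrE ?divr_gt0// div1r -[2]invrK lef_pV2 ?posrE ?invr_gt0.
have L0 : 0 <= ln (1 / eps) by rewrite (le_trans _ hL)// ltW.
rewrite powRr1// mulrDl -natr1 lerD//.
  by have /andP[] := truncn_itv (mulr_ge0 M0 L0).
by rewrite mulrC ler_pdivlMr// (mul1r (ln 2)).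
Qed.

Theorem theorem3 (R : realType) :
  exists T : R -> nat,
    [/\ forall eps : R, 0 < eps -> (0 < T eps)%N,
        polylog_bounded T
      & exists C : R, 0 < C /\
          forall eps : R, 0 < eps ->
          forall n : R, 0 < n ->
          forall (l : int) (k : nat),
            separated_approx (block l k) (exp_divergence n)
              (T eps) (C * eps)].
Proof.
pose M : R := 12 * expR 1 + 1.
have M0 : 0 <= M by rewrite addr_ge0// mulr_ge0// expR_ge0.
(* The successor keeps the count positive even when eps >= 1, and above M ln(1/eps). *)
exists (fun eps => (Num.truncn (M * ln (1 / eps))).+1).
split=> //; first exact: polylog_bounded_truncn.
exists 1; split => // eps eps0 n n0 l k; rewrite (mul1r eps).
have [c c0 sides] := block_opposite_sides R l k.
apply: (separated_approx_opposite_sides c0 n0 eps0 sides).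
exact/ltW/truncnS_gt.
Qed.
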